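(* Let $R,M,\mu>0$. There do not exist $\alpha>1/2$, $C>0$ and $\delta_0>0$ with the following property: for every $\delta\in(0,\delta_0]$, every Hilbert space $H$, every proper lower semicontinuous $F:H\to(-\infty,+\infty]$ and every $\widetilde F:H\to(-\infty,+\infty]$ such that, with $X^\star:=\operatorname{argmin}_H F$, $$\mathcal G_{R,M}(F,\widetilde F)\le\delta,\qquad F(x)-\inf_H F\ge\frac{\mu}{2}\,\mathrm{dist}(x,X^\star)^2\quad\text{for all }x\in H\text{ with }\|x\|\le R,$$ and all points $x^\star\in X^\star\cap B(0,R)$ and $\widetilde x^\star\in\operatorname{argmin}_{\|x\|\le R}\widetilde F$ with $$F(x^\star),\ \widetilde F(x^\star),\ F(\widetilde x^\star),\ \widetilde F(\widetilde x^\star)\in[-M,M],$$ one has $$\mathrm{dist}(\widetilde x^\star,X^\star)\le C\,\delta^\alpha.$$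
   Context: $B(0,R)=\{x\in H:\|x\|\le R\}$. For nonempty $S\subset H$, $\mathrm{dist}(x,S):=\inf_{y\in S}\|x-y\|$. $\operatorname{argmin}_{\|x\|\le R}\widetilde F$ is the set of minimizers of $\widetilde F$ over the ball $B(0,R)$. For a functional $F:H\to(-\infty,+\infty]$, the vertical distance-to-epigraph map is, for $(x,t)\in H\times\mathbb{R}$, $$d_F^{\mathrm v}(x,t):=\inf_{s\in\mathbb{R},\,s\ge F(x)}|t-s|=(F(x)-t)_+\in[0,+\infty],\qquad (r)_+:=\max\{r,0\}.$$ For $R,M>0$ let $C_{R,M}:=\{(x,t)\in H\times\mathbb{R}:\ \|x\|\le R,\ |t|\le M\}$. The localized vertical epigraphic gauge is $$\mathcal G_{R,M}(F,\widetilde F):=\sup_{(x,t)\in C_{R,M}}\bigl|d_F^{\mathrm v}(x,t)-d_{\widetilde F}^{\mathrm v}(x,t)\bigr|\in[0,+\infty],$$ with the convention that the difference is $0$ where both distances equal $+\infty$ (and its absolute value is $+\infty$ where exactly one of them does). *)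

(* Defs.v *)
From HB Require Import structures.
From mathcomp Require Import all_boot all_order all_algebra.
From mathcomp Require Import all_classical all_reals all_analysis.

Set Implicit Arguments.
Unset Strict Implicit.
Unset Printing Implicit Defensive.

Import Order.TTheory GRing.Theory Num.Theory.
Import numFieldNormedType.Exports.

Local Open Scope classical_set_scope.
Local Open Scope ring_scope.

(* A real Hilbert space: a complete normed space whose norm comes from an
   inner product. *)
HB.mixin Record CompleteNormedModule_isHilbert (R : realType) H
    of CompleteNormedModule R H := {
  inner : {dot H for @idfun R} ;
  inner_norm : forall x : H, inner x x = `|x| ^+ 2
}.

#[short(type="hilbertType")]
HB.structure Definition Hilbert (R : realType) :=
  { H of CompleteNormedModule R H & CompleteNormedModule_isHilbert R H }.

Section Epigraphs.
Context {R : realType} {H : hilbertType R}.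
Implicit Types (F G : H -> \bar R) (S : set H) (x : H) (r t m : R).

Local Open Scope ereal_scope.

Definition cball r : set H := [set x | (`|x| <= r)%R].

(* Only meaningful for nonempty [S]; the value is [+oo] on [set0]. *)
Definition dist_to x S : \bar R := ereal_inf [set `|(x - y)%R|%:E | y in S].

Definition argmin_on S F : set H :=
  [set x | S x /\ forall y, S y -> F x <= F y].

Definition argmin F : set H := argmin_on setT F.

Definition no_minus_infty F := forall x, F x != -oo.

Definition proper_fun F := no_minus_infty F /\ exists x, F x != +oo.

(* Distance from (x, t) to the epigraph of [F] along the vertical line through
   x; it is [+oo] when [F x = +oo] since the infimum is then over set0. *)
Definition vdist F x t : \bar R :=
  ereal_inf [set `|(t - s)%R|%:E | s in [set s : R | F x <= s%:E]].

(* The case distinction is needed because [+oo - +oo = -oo] in [\bar R]. *)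
Definition absdiff (a b : \bar R) : \bar R :=
  if (a == +oo) && (b == +oo) then 0 else `|a - b|.

Definition cylinder r m : set (H * R) :=
  [set p | (`|p.1| <= r)%R /\ (`|p.2| <= m)%R].

Definition vgauge r m F G : \bar R :=
  ereal_sup
    [set absdiff (vdist F p.1 p.2) (vdist G p.1 p.2) | p in cylinder r m].

Lemma vdistE F x t : vdist F x t = maxe (F x - t%:E) 0.
Proof.
rewrite /vdist; case: (F x) => [a| |].
- apply/eqP; rewrite eq_le; apply/andP; split.
    apply: ereal_inf_lbound; exists (Num.max a t) => /=.
      by rewrite lee_fin le_max lexx.
    rewrite -EFinB -EFin_max; congr EFin.
    have [at_|ta] := leP a t; first by rewrite subrr normr0 max_r// subr_le0.
    by rewrite distrC gtr0_norm ?subr_gt0// max_l// subr_ge0 ltW.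
  apply: le_ereal_inf_tmp => _ [s /= as_ <-].
  rewrite -EFinB -EFin_max lee_fin ge_max normr_ge0 andbT distrC.
  rewrite lee_fin in as_.
  by rewrite (le_trans _ (ler_norm _))// lerD2r.
- rewrite addye// max_l ?leey// (_ : [set s : R | _] = set0).
    by rewrite image_set0 ereal_inf0.
  by apply/seteqP; split => s //=.
- rewrite addNye max_r ?leNye//; apply/eqP; rewrite eq_le; apply/andP; split.
    by apply: ereal_inf_lbound; exists t => //=; rewrite ?leNye// subrr normr0.
  by apply: le_ereal_inf_tmp => _ [s _ <-]; rewrite lee_fin.
Qed.

End Epigraphs.

(* Main.v *)
From HB Require Import structures.
Require Import Defs.
From mathcomp Require Import all_boot all_order all_algebra.
From mathcomp Require Import all_classical all_reals all_analysis.
From mathcomp Require Import lra.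

(** The obstruction is one-dimensional: on the line, let F be the parabola
    c x^2 with c = mu / 2, whose growth inequality is an equality, and lower
    its value at the single point a = sqrt (delta / c) from F a = delta to 0.
    The result Ft differs from F by at most delta, hence so do the vertical
    distances to the epigraphs ([vgauge_EFin_le]), whatever the cylinder; yet
    a has become a minimizer of Ft, at distance sqrt (delta / c) from the only
    minimizer 0 of F.  A bound C delta^alpha would thus dominate
    sqrt (delta / c) for all small delta, which is impossible when
    alpha > 1 / 2 ([near_powR_lt_sqrt]). *)

Import Order.TTheory GRing.Theory Num.Theory.
Import numFieldNormedType.Exports.

Local Open Scope classical_set_scope.
Local Open Scope ring_scope.

(** * The line as a Hilbert space *)

Section RealLine.
Variable R : realType.

Definition mul_form (x y : R^o) : R := x * y.

Let mul_form_bilinear :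
  bilinear_for (GRing.Scale.Law.clone _ _ *%R _)
    (GRing.Scale.Law.clone _ _ (@idfun R \; *%R) _) mul_form.
Proof.
split=> y; rewrite /mul_form => a u v /=.
- by rewrite mulrDl -mulrA.
- by rewrite mulrDr mulrCA.
Qed.

HB.instance Definition _ := bilinear_isBilinear.Build R R^o R^o R
  _ _ mul_form mul_form_bilinear.

Let mul_form_sym (x y : R^o) :
  mul_form x y = (-1) ^+ false * idfun (mul_form y x).
Proof. by rewrite expr0 mul1r /= /mul_form mulrC. Qed.

HB.instance Definition _ := isHermitianSesquilinear.Build R R^o
  false idfun mul_form mul_form_sym.

Let mul_form_gt0 (x : R^o) : x != 0 -> 0 < mul_form x x.
Proof. by move=> x0; rewrite /mul_form -expr2 exprn_even_gt0. Qed.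

HB.instance Definition _ := isDotProduct.Build R R^o mul_form mul_form_gt0.

Let mul_form_norm (x : R^o) : mul_form x x = `|x| ^+ 2.
Proof. by rewrite /mul_form real_normK ?num_real// expr2. Qed.

HB.instance Definition _ := CompleteNormedModule_isHilbert.Build R R^o
  mul_form_norm.

End RealLine.

(** * Epigraphic calculus *)

Section Calculus.
Context {R : realType}.

(** [max _ 0] is 1-Lipschitz; this is what transfers a uniform bound between
    functions to their vertical distances. *)
Lemma ler_dist_max0 (a b : R) :
  `|Num.max a 0 - Num.max b 0| <= `|a - b|.
Proof.
rewrite ler_norml; have := ler_norm (a - b); have := ler_norm (b - a).
rewrite (distrC b a); set n := `|a - b|.
by case: (leP a 0); case: (leP b 0); move=> *; apply/andP; split; lra.
Qed.

(** On finite functions [vdist] is the positive part of f x - t, and the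
    subtraction of the height t cancels in the difference: hence a bound
    independent of the cylinder. *)
Lemma vgauge_EFin_le (H : hilbertType R) (r m d : R) (f g : H -> R) :
  (forall x, `|f x - g x| <= d) ->
  (vgauge r m (fun x => (f x)%:E) (fun x => (g x)%:E) <= d%:E)%E.
Proof.
move=> fgd; apply: ge_ereal_sup => _ [[x t] _ <-] /=.
rewrite !vdistE -!EFinB -!EFin_max /absdiff /= lee_fin.
apply: le_trans (ler_dist_max0 _ _) _.
by rewrite opprB addrA subrK.
Qed.

Lemma lower_semicontinuous_EFin (T : topologicalType) (f : T -> R) :
  continuous f -> lower_semicontinuous (fun x => (f x)%:E).
Proof.
move=> fcont x a; rewrite lte_fin => afx.
exists [set y | a < f y] => [|y]; last by rewrite /= lte_fin.
exact: (cvgr_gt _ (fcont x)).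
Qed.

Lemma dist_to_set1 (H : hilbertType R) (x y : H) :
  dist_to x [set y] = `|x - y|%:E.
Proof. by rewrite /dist_to image_set1 ereal_inf1. Qed.

End Calculus.

(** * The parabola lowered at one point *)

Section Parabola.
Context {R : realType} {H : hilbertType R}.
Variable c : R.
Hypothesis c_gt0 : 0 < c.

Definition parabola (x : H) : R := c * `|x| ^+ 2.

Definition dented_parabola (a x : H) : R := if x == a then 0 else parabola x.

Lemma parabola_ge0 x : 0 <= parabola x.
Proof. by rewrite mulr_ge0 ?exprn_ge0// ltW. Qed.

Lemma parabola0 : parabola 0 = 0.
Proof. by rewrite /parabola normr0 expr0n mulr0. Qed.

Lemma continuous_parabola : continuous parabola.
Proof.
move=> x; apply: cvgMr; rewrite expr2.
by under eq_fun do rewrite expr2; apply: cvgM; exact: norm_continuous.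
Qed.

Lemma argmin_parabola : argmin (fun x => (parabola x)%:E) = [set 0].
Proof.
apply/seteqP; split => [x [_ /(_ 0 I)]|x ->]; last first.
  by split => // y _; rewrite lee_fin parabola0 parabola_ge0.
rewrite lee_fin parabola0 /parabola pmulr_rle0// => x2le0.
by apply/eqP; rewrite -normr_eq0 -sqrf_eq0 eq_le x2le0 exprn_ge0.
Qed.

Lemma inf_parabola : ereal_inf (range (fun x => (parabola x)%:E)) = 0%E.
Proof.
apply/eqP; rewrite eq_le; apply/andP; split.
  by apply: ereal_inf_lbound; exists 0; rewrite ?parabola0.
by apply: le_ereal_inf_tmp => _ [x _ <-]; rewrite lee_fin parabola_ge0.
Qed.

Lemma dented_parabola_ge0 a x : 0 <= dented_parabola a x.
Proof. by rewrite /dented_parabola; case: ifP => // _; exact: parabola_ge0. Qed.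

Lemma dented_parabola_dist a x :
  `|parabola x - dented_parabola a x| <= parabola a.
Proof.
rewrite /dented_parabola; case: eqP => [->|_].
  by rewrite subr0 ger0_norm// parabola_ge0.
by rewrite subrr normr0 parabola_ge0.
Qed.

Lemma argmin_dented_parabola (S : set H) a :
  S a -> argmin_on S (fun x => (dented_parabola a x)%:E) a.
Proof.
move=> Sa; split=> // y _.
by rewrite lee_fin {1}/dented_parabola eqxx dented_parabola_ge0.
Qed.

End Parabola.

(** * Comparison of rates *)

(** Dividing by delta^(1/2) leaves the positive power delta^(alpha - 1/2),
    which tends to 0 from the right. *)
Lemma near_powR_lt_sqrt (R : realType) (alpha C c : R) :
  1 / 2 < alpha -> 0 < C -> 0 < c ->
  \forall d \near 0^'+, C * d `^ alpha < Num.sqrt (d / c).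
Proof.
move=> alpha_gt C_gt0 c_gt0.
have sc_gt0 : 0 < Num.sqrt c by rewrite sqrtr_gt0.
have beta_gt0 : 0 < alpha - 1 / 2 by rewrite subr_gt0.
near=> d.
have d_gt0 : 0 < d by near: d; exact: nbhs_right_gt.
have small : d `^ (alpha - 1 / 2) < (C * Num.sqrt c)^-1.
  near: d; apply: (cvgr_lt _ (powR_cvg0 beta_gt0)).
  by rewrite invr_gt0 mulr_gt0.
rewrite sqrtrM ?(ltW d_gt0)// sqrtrV ?(ltW c_gt0)// ltr_pdivlMr//.
rewrite -(subrK (1 / 2) alpha) powRD; last by rewrite (gt_eqF d_gt0) implybT.
rewrite [d `^ (1 / 2)](_ : _ = Num.sqrt d); last first.
  by rewrite div1r powR12_sqrt// ltW.
rewrite mulrA mulrAC gtr_pMl ?sqrtr_gt0//.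
by rewrite mulrAC mulrC -ltr_pdivlMr ?mulr_gt0// [ltRHS]div1r.
Unshelve. all: by end_near.
Qed.

Theorem proposition2 (R : realType) (r M mu : R)
    (hr : 0 < r) (hM : 0 < M) (hmu : 0 < mu) :
  ~ exists alpha C delta0 : R,
      [/\ 1 / 2 < alpha, 0 < C, 0 < delta0 &
        forall (delta : R), 0 < delta -> delta <= delta0 ->
        forall (H : hilbertType R) (F Ft : H -> \bar R),
          proper_fun F -> lower_semicontinuous F -> no_minus_infty Ft ->
          (vgauge r M F Ft <= delta%:E)%E ->
          (forall x : H, `|x| <= r ->
             ((mu / 2)%:E * dist_to x (argmin F) ^+ 2
                <= F x - ereal_inf (range F))%E) ->
        forall xs xt : H,
          (argmin F `&` cball r) xs ->
          argmin_on (cball r) Ft xt ->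
          ((- M)%:E <= F xs <= M%:E)%E ->
          ((- M)%:E <= Ft xs <= M%:E)%E ->
          ((- M)%:E <= F xt <= M%:E)%E ->
          ((- M)%:E <= Ft xt <= M%:E)%E ->
          (dist_to xt (argmin F) <= (C * delta `^ alpha)%:E)%E].
Proof.
case=> alpha [C [d0 [alpha_gt C_gt0 d0_gt0 rate]]].
pose c := mu / 2; have c_gt0 : 0 < c by rewrite divr_gt0.
(* d <= M keeps F a = d in [-M, M]; d <= c r^2 keeps a in the ball. *)
have [d [d_gt0 dd0 dM dr dlt]] : exists d,
    [/\ 0 < d, d <= d0, d <= M, d <= c * r ^+ 2 &
        C * d `^ alpha < Num.sqrt (d / c)].
  near (0:R)^'+ => d; exists d; split; near: d.
  - exact: nbhs_right_gt.
  - exact: nbhs_right_le.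
  - exact: nbhs_right_le.
  - by apply: nbhs_right_le; rewrite mulr_gt0 ?exprn_gt0.
  - exact: near_powR_lt_sqrt.
pose a : R^o := Num.sqrt (d / c).
have norm_a : `|a| = Num.sqrt (d / c) by rewrite ger0_norm ?sqrtr_ge0.
have parabola_a : parabola c a = d.
  rewrite /parabola norm_a sqr_sqrtr; last by rewrite divr_ge0 ?ltW.
  by rewrite mulrC divfK ?gt_eqF.
have ball_a : cball r a.
  rewrite /cball /= norm_a -[leRHS](ger0_norm (ltW hr)) -sqrtr_sqr.
  by rewrite ler_wsqrtr// ler_pdivrMr// mulrC.
have M_ge0 : 0 <= M by exact: ltW.
have NM_le0 : - M <= 0 by rewrite oppr_le0.
have d_ge0 : 0 <= d by exact: ltW.
have dented0 : dented_parabola c a 0 = 0.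
  by rewrite /dented_parabola parabola0; case: ifP.
have dented_a : dented_parabola c a a = 0 by rewrite /dented_parabola eqxx.
have : (dist_to a (argmin (fun x : R^o => (parabola c x)%:E))
          <= (C * d `^ alpha)%:E)%E.
  apply: (rate d d_gt0 dd0 R^o (fun x => (parabola c x)%:E)
            (fun x => (dented_parabola c a x)%:E) _ _ _ _ _ 0 a).
  - by split=> //; exists 0.
  - by apply: lower_semicontinuous_EFin; exact: continuous_parabola.
  - by [].
  - apply: vgauge_EFin_le => x; rewrite -parabola_a.
    exact: dented_parabola_dist.
  - move=> x _; rewrite argmin_parabola// inf_parabola// dist_to_set1.
    by rewrite subr0 sube0 -EFin_expe -EFinM.
  - by rewrite argmin_parabola//; split=> //=; rewrite /cball /= normr0 ltW.
  - exact: argmin_dented_parabola.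
  - by rewrite parabola0 !lee_fin NM_le0.
  - by rewrite dented0 !lee_fin NM_le0.
  - by rewrite parabola_a !lee_fin dM (le_trans NM_le0).
  - by rewrite dented_a !lee_fin NM_le0.
rewrite argmin_parabola// dist_to_set1 subr0 norm_a lee_fin.
by rewrite leNgt dlt.
Unshelve. all: by end_near.
Qed.
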